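(* Let $\gamma>1$ and let $U_0=(q_0,\rho_0,p_0)$ be a uniform supersonic state with positive components and Mach number $M_0=\sqrt{\rho_0q_0^2/(\gamma p_0)}>1$, such that either (S1) $1<\gamma<3$ and $1<M_0^2\le\frac{3\gamma-1}{\gamma(3-\gamma)}$, or (S2) $\gamma\ge3$ and $M_0>1$. Let $U_1=(q_1,\rho_1,p_1)$ be the uniform subsonic state connected to $U_0$ by the Rankine–Hugoniot conditions, $p_*=\frac{p_0+p_1}2$ and $A=\rho_0q_0^2+p_0$. Then for any $\epsilon>0$ and any $p_e\in(0,p_* )\cup(p_*,p_1)\cup(p_1,\frac A2)$ there exists a solution $U=U^\epsilon(x)=(u,\rho,p)\in C^2([0,1])$ of $$\partial_x(\rho u)=0,\quad \partial_x(\rho u^2+p)=0,\quad \partial_x(\rho u\Phi)=\epsilon\,\partial_{xx}e,\qquad U(0)=U_1,\quad p(1)=p_e .$$ More precisely: - if $p_e\in(0,p_* )$, then the solution $U^\epsilon$ is transonic (subsonic–supersonic); - if $p_e\in(p_*,p_1)\cup(p_1,\frac A2)$, then the solution $U^\epsilon$ is subsonic.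
   Context: Here $u,\rho,p$ are velocity, density and pressure, $e=\frac1{\gamma-1}\frac p\rho$ and $\Phi=\frac12u^2+\frac{\gamma}{\gamma-1}\frac p\rho$. The Mach number is $M=|u|/\sqrt{\gamma p/\rho}$; the flow is supersonic where $M>1$ and subsonic where $M<1$. The state $U_1$ is the unique subsonic state with $\rho_0q_0=\rho_1q_1$, $\rho_0q_0^2+p_0=\rho_1q_1^2+p_1$, $\Phi_0=\Phi_1$, where $\Phi_i=\frac12q_i^2+\frac{\gamma}{\gamma-1}\frac{p_i}{\rho_i}$; one has $p_1>p_0$. A solution is subsonic if $M<1$ on all of $[0,1]$. It is transonic (subsonic–supersonic) if there is $\hat x\in(0,1)$ such that the flow is subsonic for $x<\hat x$ and supersonic for $x>\hat x$.
   Formalization: If equality holds in (S1), i.e. p_1 = A/2, no C^2([0,1]) solution with p(1) = p_e < A/2 exists; there the solution is only claimed continuous on [0,1], and C^2 satisfying the equations on (0,1]. *)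

(* Defs.v *)
From Stdlib Require Import Reals.
Open Scope R_scope.

Record state := mkState { vel : R; dens : R; pres : R }.

Definition positive_state (U : state) : Prop :=
  0 < vel U /\ 0 < dens U /\ 0 < pres U.

Definition mach (gamma : R) (U : state) : R :=
  Rabs (vel U) / sqrt (gamma * pres U / dens U).

Definition internal_energy (gamma : R) (U : state) : R :=
  1 / (gamma - 1) * (pres U / dens U).

Definition total_enthalpy (gamma : R) (U : state) : R :=
  1 / 2 * vel U ^ 2 + gamma / (gamma - 1) * (pres U / dens U).

Definition rankine_hugoniot (gamma : R) (U0 U1 : state) : Prop :=
  dens U0 * vel U0 = dens U1 * vel U1 /\
  dens U0 * vel U0 ^ 2 + pres U0 = dens U1 * vel U1 ^ 2 + pres U1 /\
  total_enthalpy gamma U0 = total_enthalpy gamma U1.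

Definition cc01 (x : R) : Prop := 0 <= x <= 1.
Definition oc01 (x : R) : Prop := 0 < x <= 1.

Definition C0_on (J : R -> Prop) (f : R -> R) : Prop :=
  forall x, J x -> continue_in f J x.

(* [D_in f f' J x] is differentiability relative to [J], hence one-sided at an
   endpoint of [J] that belongs to [J]. *)
Definition C2_on (J : R -> Prop) (f : R -> R) : Prop :=
  exists f' f'' : R -> R,
    forall x, J x ->
      D_in f f' J x /\ D_in f' f'' J x /\ continue_in f'' J x.

Definition C0_state_on (J : R -> Prop) (U : R -> state) : Prop :=
  C0_on J (fun x => vel (U x)) /\
  C0_on J (fun x => dens (U x)) /\
  C0_on J (fun x => pres (U x)).

Definition C2_state_on (J : R -> Prop) (U : R -> state) : Prop :=
  C2_on J (fun x => vel (U x)) /\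
  C2_on J (fun x => dens (U x)) /\
  C2_on J (fun x => pres (U x)).

(* Positivity of density and pressure is what makes the Mach number, [e] and
   [Phi] meaningful. *)
Definition steady_solution (gamma eps : R) (J : R -> Prop) (U : R -> state)
    : Prop :=
  C2_state_on J U /\
  (forall x, J x -> 0 < dens (U x) /\ 0 < pres (U x)) /\
  (forall x, J x -> D_in (fun y => dens (U y) * vel (U y)) (fun _ => 0) J x) /\
  (forall x, J x ->
     D_in (fun y => dens (U y) * vel (U y) ^ 2 + pres (U y))
       (fun _ => 0) J x) /\
  exists e' e'' : R -> R,
    forall x, J x ->
      D_in (fun y => internal_energy gamma (U y)) e' J x /\
      D_in e' e'' J x /\
      D_in (fun y => dens (U y) * vel (U y) * total_enthalpy gamma (U y))
        (fun y => eps * e'' y) J x.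

Definition subsonic_flow (gamma : R) (U : R -> state) : Prop :=
  forall x, cc01 x -> mach gamma (U x) < 1.

Definition transonic_flow (gamma : R) (U : R -> state) : Prop :=
  exists xhat, 0 < xhat < 1 /\
    forall x, cc01 x ->
      (x < xhat -> mach gamma (U x) < 1) /\
      (xhat < x -> 1 < mach gamma (U x)).

(* Main.v *)
Require Import Defs.
From Stdlib Require Import Reals Lra Psatz Ranalysis5 ClassicalEpsilon.
From Coquelicot Require Import Coquelicot.
Open Scope R_scope.

(** Along a solution the mass flux [m] and the momentum flux [A] are constant,
    so that velocity and density are functions of the pressure alone:
    [u = (A - p) / m] and [rho = m^2 / (A - p)].  The flow is then sonic exactly
    at [ps = A / (gamma + 1)].  The internal energy is a multiple of
    [p (A - p)], and the total enthalpy is a concave quadratic in [p] with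
    maximum at [ps]; hence equal enthalpies at [p0] and [p1] give
    [p0 + p1 = 2 ps], and the pressure [pstar] of the statement is the sonic
    pressure.  The energy equation, integrated once with an unknown constant of
    integration, becomes the autonomous scalar equation
      [(A - 2 p) p' = kappa (lam - (p - ps)^2)],
      [kappa = (gamma + 1) m / (2 eps)],
    with [lam] free.  The conditions on [gamma] and the upstream Mach number amount
    to [p1 <= A / 2], so the factor [A - 2 p] is positive between the two boundary
    pressures, except at [x = 0] if [p1 = A / 2].

    It remains to choose [lam] so that the solution starting from [p1] reaches
    [pe] at [x = 1].  Write [p = p1 + s (pe - p1)]; the equation reads
    [s' = kappa (k s + delta) / W s], where [W] is the weight
    [(A - 2 p) |pe - p1|], [k >= 0] vanishes somewhere in [0 < s <= 1], and
    [delta > 0] is the shooting parameter replacing [lam].  The time needed to go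
    from [s = 0] to [s = 1] is the integral of [W / (k + delta)] divided by
    [kappa]; it is continuous in [delta], tends to [0] as [delta] grows, and
    diverges logarithmically as [delta] tends to [0], because [k] vanishes at
    least linearly at its zero ([travel_time_onto]).  So some [delta] makes
    this time equal to [1], and the inverse of the partial travel time is the
    profile ([separable_connection]).

    The zero of [k] is where the right-hand side of the scalar equation
    degenerates first ([pressure_profile]): at the end point [s = 1] if [pe] lies
    on the subsonic side of [ps], and at the sonic point if [pe < ps].  In both
    cases the pressure is monotone, so it stays above [ps] in the first case
    and crosses [ps] exactly once in the second. *)

(** * Shooting for the travel time *)

Lemma continuous_div_reg (W k : R -> R) (delta s : R) :
  (forall x, continuous W x) -> (forall x, continuous k x) ->
  (forall x, 0 <= k x) -> 0 < delta ->
  continuous (fun s => W s / (k s + delta)) s.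
Proof.
  intros HW Hk Hk0 Hd.
  apply (continuous_mult W (fun s => / (k s + delta))); [apply HW|].
  apply continuous_comp with (g := Rinv).
  - apply (continuous_plus k (fun _ => delta)); [apply Hk|apply continuous_const].
  - apply continuous_Rinv. specialize (Hk0 s). lra.
Qed.

Lemma ex_RInt_cont (f : R -> R) (a b : R) :
  (forall x, continuous f x) -> ex_RInt f a b.
Proof. intros H. apply (ex_RInt_continuous (V := R_CompleteNormedModule)). auto. Qed.

Lemma RInt_Chasles_R (f : R -> R) (a b c : R) :
  (forall x, continuous f x) -> RInt f a c = RInt f a b + RInt f b c.
Proof.
  intros H. symmetry.
  apply (RInt_Chasles (V := R_CompleteNormedModule)); apply ex_RInt_cont; auto.
Qed.

Section Shooting.
Variables (W k : R -> R).
Hypothesis HW : forall s, continuous W s.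
Hypothesis Hk : forall s, continuous k s.
Hypothesis HW0 : forall s, 0 <= W s.
Hypothesis Hk0 : forall s, 0 <= k s.

Let F delta := RInt (fun s => W s / (k s + delta)) 0 1.

Let ex_F delta a b : 0 < delta -> ex_RInt (fun s => W s / (k s + delta)) a b.
Proof.
  intros Hd. apply ex_RInt_cont. intros; apply continuous_div_reg; auto.
Qed.

Lemma travel_time_le (delta : R) : 0 < delta -> F delta <= RInt W 0 1 / delta.
Proof.
  intros Hd. unfold F.
  replace (RInt W 0 1 / delta) with (RInt (fun s => / delta * W s) 0 1).
  2:{ replace (RInt W 0 1 / delta) with (/ delta * RInt W 0 1) by (field; lra).
      apply (RInt_scal (V := R_CompleteNormedModule)).
      apply ex_RInt_cont; auto. }
  apply RInt_le; [lra | apply ex_F; auto | |].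
  - apply ex_RInt_cont. intros x.
    apply (continuous_scal_r (/ delta) W x). apply HW.
  - intros x _. unfold Rdiv. rewrite Rmult_comm.
    apply Rmult_le_compat_r; [apply HW0|].
    apply Rinv_le_contravar; [lra|]. specialize (Hk0 x). lra.
Qed.

(** The difference of the two integrands is
    [(d2 - d1) W / ((k + d1) (k + d2))], and both denominators are at least
    [d]. *)
Lemma travel_time_lipschitz (d d1 d2 : R) :
  0 < d -> d <= d1 -> d <= d2 ->
  Rabs (F d1 - F d2) <= Rabs (d1 - d2) * (RInt W 0 1 / d ^ 2).
Proof.
  intros Hd H1 H2. unfold F.
  rewrite <- (RInt_minus (V := R_CompleteNormedModule)) by (apply ex_F; lra).
  replace (Rabs (d1 - d2) * (RInt W 0 1 / d ^ 2))
    with (RInt (fun s => Rabs (d1 - d2) / d ^ 2 * W s) 0 1).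
  2:{ replace (Rabs (d1 - d2) * (RInt W 0 1 / d ^ 2))
        with (Rabs (d1 - d2) / d ^ 2 * RInt W 0 1) by (field; lra).
      apply (RInt_scal (V := R_CompleteNormedModule)).
      apply ex_RInt_cont; auto. }
  eapply Rle_trans.
  { apply abs_RInt_le; [lra|].
    apply (ex_RInt_minus (V := R_CompleteNormedModule)); apply ex_F; lra. }
  apply RInt_le; [lra | | |].
  - apply ex_RInt_cont. intros x.
    apply continuous_comp with (g := Rabs); [|apply continuous_Rabs].
    apply (continuous_minus (V := R_NormedModule)); apply continuous_div_reg; auto; lra.
  - apply ex_RInt_cont. intros x.
    apply (continuous_scal_r (Rabs (d1 - d2) / d ^ 2) W x). apply HW.
  - intros x _. unfold minus, plus, opp; simpl.
    pose proof (Hk0 x) as Kx. pose proof (HW0 x) as Wx.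
    replace (W x / (k x + d1) + - (W x / (k x + d2)))
      with (- (d1 - d2) * (W x * (/ (k x + d1) * / (k x + d2)))) by (field; lra).
    assert (0 < / (k x + d1)) by (apply Rinv_0_lt_compat; lra).
    assert (0 < / (k x + d2)) by (apply Rinv_0_lt_compat; lra).
    assert (/ (k x + d1) <= / d) by (apply Rinv_le_contravar; lra).
    assert (/ (k x + d2) <= / d) by (apply Rinv_le_contravar; lra).
    rewrite Rabs_mult, Rabs_Ropp.
    rewrite (Rabs_pos_eq (W x * _)) by (apply Rmult_le_pos; nra).
    replace (Rabs (d1 - d2) / (d * (d * 1)) * W x)
      with (Rabs (d1 - d2) * (W x * (/ d * / d))) by (field; lra).
    apply Rmult_le_compat_l; [apply Rabs_pos|].
    apply Rmult_le_compat_l; [assumption|].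
    apply Rmult_le_compat; lra.
Qed.

(** Near the zero [sc] of [k] the integrand is at least
    [c0 / (K (sc - s) + delta)], whose integral grows like
    [(c0 / K) ln (1 / delta)].  Only the left half-neighbourhood
    [sc / 2 <= s <= sc] is used, so that [sc = 1] is allowed and [W] may vanish
    at [0]. *)
Lemma travel_time_large (sc K kappa : R) :
  0 < sc <= 1 -> 0 < K ->
  (forall s, 0 < s <= 1 -> 0 < W s) ->
  (forall s, 0 <= s <= sc -> k s <= K * (sc - s)) ->
  exists delta, 0 < delta /\ kappa < F delta.
Proof.
  intros Hsc HK HWpos Hkle.
  destruct (continuity_ab_min W (sc / 2) sc) as [mx [Hmx Imx]]; [lra| |].
  { intros c _. apply continuity_pt_filterlim, HW. }
  set (c0 := W mx) in *.
  assert (Hc0 : 0 < c0) by (apply HWpos; lra).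
  (* The value for which c0 / K * (ln (K * (sc / 2)) - ln delta) = kappa. *)
  set (delta := K * (sc / 2) * exp (- (kappa * K / c0))).
  assert (Hd : 0 < delta).
  { unfold delta. apply Rmult_lt_0_compat; [nra|apply exp_pos]. }
  exists delta; split; [assumption|].
  set (f := fun s => W s / (k s + delta)).
  assert (Cf : forall x, continuous f x)
    by (intros; apply continuous_div_reg; auto).
  assert (Pf : forall x, 0 <= f x).
  { intros x. apply Rdiv_le_0_compat; [apply HW0|]. specialize (Hk0 x); lra. }
  set (h := fun s => c0 / (K * (sc - s) + delta)).
  assert (Ih : is_RInt h (sc / 2) sc
     (c0 / K * (ln (K * (sc / 2) + delta) - ln delta))).
  { set (H := fun s => - (c0 / K) * ln (K * (sc - s) + delta)).
    replace (c0 / K * (ln (K * (sc / 2) + delta) - ln delta))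
      with (H sc - H (sc / 2)).
    2:{ unfold H. replace (K * (sc - sc) + delta) with delta by ring.
        replace (K * (sc - sc / 2) + delta) with (K * (sc / 2) + delta) by field.
        ring. }
    apply (is_RInt_derive (V := R_CompleteNormedModule) H h).
    - intros x Hx. rewrite Rmin_left, Rmax_right in Hx by lra.
      assert (0 < K * (sc - x) + delta) by nra.
      unfold H, h. auto_derive; [assumption|]. field. split; lra.
    - intros x Hx. rewrite Rmin_left, Rmax_right in Hx by lra.
      assert (0 < K * (sc - x) + delta) by nra.
      apply (ex_derive_continuous h). unfold h. auto_derive. lra. }
  assert (L1 : RInt h (sc / 2) sc <= RInt f (sc / 2) sc).
  { apply RInt_le; [lra | eexists; apply Ih | apply ex_RInt_cont; auto |].
    intros x Hx. unfold h, f, Rdiv.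
    assert (0 <= k x) by apply Hk0.
    assert (k x <= K * (sc - x)) by (apply Hkle; lra).
    apply Rmult_le_compat; [lra | left; apply Rinv_0_lt_compat; lra | |].
    - apply Hmx; lra.
    - apply Rinv_le_contravar; lra. }
  rewrite (is_RInt_unique _ _ _ _ Ih) in L1.
  assert (L2 : kappa < c0 / K * (ln (K * (sc / 2) + delta) - ln delta)).
  { assert (ln (K * (sc / 2)) < ln (K * (sc / 2) + delta))
      by (apply ln_increasing; nra).
    assert (E : ln delta = ln (K * (sc / 2)) - kappa * K / c0).
    { unfold delta. rewrite ln_mult, ln_exp; [ring|nra|apply exp_pos]. }
    rewrite E.
    assert (0 < c0 / K) by (apply Rdiv_lt_0_compat; lra).
    replace kappa with (c0 / K * (kappa * K / c0)) at 1 by (field; lra).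
    apply Rmult_lt_compat_l; lra. }
  unfold F. fold f.
  rewrite (RInt_Chasles_R f 0 (sc / 2) 1), (RInt_Chasles_R f (sc / 2) sc 1) by auto.
  assert (0 <= RInt f 0 (sc / 2))
    by (apply RInt_ge_0; [lra | apply ex_RInt_cont; auto | auto]).
  assert (0 <= RInt f sc 1)
    by (apply RInt_ge_0; [lra | apply ex_RInt_cont; auto | auto]).
  lra.
Qed.

Lemma travel_time_onto (sc K kappa : R) :
  0 < sc <= 1 -> 0 < K -> 0 < kappa ->
  (forall s, 0 < s <= 1 -> 0 < W s) ->
  (forall s, 0 <= s <= sc -> k s <= K * (sc - s)) ->
  exists delta, 0 < delta /\ F delta = kappa.
Proof.
  intros Hsc HK Hkap HWpos Hkle.
  destruct (travel_time_large sc K kappa) as [d1 [Hd1 L1]]; auto.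
  set (I := RInt W 0 1).
  assert (HI : 0 <= I)
    by (apply RInt_ge_0; [lra | apply ex_RInt_cont; auto | auto]).
  assert (HIk : 0 <= I / kappa) by (apply Rdiv_le_0_compat; lra).
  (* The summand d1 puts d2 to the right of d1; the rest makes I / d2 < kappa. *)
  set (d2 := d1 + I / kappa + 1).
  assert (L2 : F d2 < kappa).
  { eapply Rle_lt_trans; [apply travel_time_le; unfold d2; lra|]. fold I.
    apply Rlt_div_l; [unfold d2; lra|].
    replace I with (kappa * (I / kappa)) at 1 by (field; lra).
    apply Rmult_lt_compat_l; unfold d2; lra. }
  destruct (IVT_interv (fun d => kappa - F d) d1 d2) as [d [Id Ed]];
    [| unfold d2; lra | lra | lra | exists d; split; lra].
  intros a Ia. apply continuity_pt_locally. intros [e He]; simpl.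
  set (L := I / (d1 / 2) ^ 2).
  assert (HL : 0 <= L) by (apply Rdiv_le_0_compat; [lra|apply pow_lt; lra]).
  assert (Hr : 0 < Rmin (d1 / 2) (e / (L + 1))).
  { apply Rmin_pos; [lra|]. apply Rdiv_lt_0_compat; lra. }
  exists (mkposreal _ Hr). intros u Hu.
  assert (Hu' : Rabs (u - a) < Rmin (d1 / 2) (e / (L + 1))) by apply Hu.
  pose proof (Rmin_l (d1 / 2) (e / (L + 1))).
  pose proof (Rmin_r (d1 / 2) (e / (L + 1))).
  assert (Hb : Rabs (u - a) < d1 / 2) by lra. apply Rabs_def2 in Hb.
  replace (kappa - F u - (kappa - F a)) with (F a - F u) by ring.
  eapply Rle_lt_trans; [apply (travel_time_lipschitz (d1 / 2)); lra|].
  fold I; fold L. rewrite (Rabs_minus_sym a u).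
  apply Rle_lt_trans with (Rabs (u - a) * (L + 1)).
  - apply Rmult_le_compat_l; [apply Rabs_pos | lra].
  - apply Rlt_div_r; lra.
Qed.

End Shooting.

(** * Inverting the partial travel time *)

Section Inverse.
Variables (T f : R -> R).
Hypothesis T0 : T 0 = 0.
Hypothesis T1 : T 1 = 1.
Hypothesis Tderive : forall s, is_derive T s (f s).
Hypothesis Tincr : forall s t, 0 <= s -> s < t -> t <= 1 -> T s < T t.

(** The values of [S] outside the unit interval are arbitrary, but bounded all
    the same: pointwise identities along the profile, such as constancy of the
    fluxes, then hold for every [x]. *)
Lemma inverse_of_increasing :
  exists S : R -> R,
    (forall x, 0 <= S x <= 1) /\
    (forall x, cc01 x -> T (S x) = x) /\
    (forall s, 0 <= s <= 1 -> cc01 (T s) /\ S (T s) = s) /\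
    (forall x y, cc01 x -> cc01 y -> x < y -> S x < S y).
Proof.
  assert (Tle : forall s t, 0 <= s -> s <= t -> t <= 1 -> T s <= T t).
  { intros s t ? [?|<-] ?; [left; auto | right; reflexivity]. }
  assert (ex : forall x, exists s, 0 <= s <= 1 /\ (cc01 x -> T s = x)).
  { intros x. destruct (classic (cc01 x)) as [Hx|Hx].
    2:{ exists 0; split; [lra|tauto]. }
    destruct (IVT_gen T 0 1 x) as [s [Is Es]].
    - intros s. apply continuity_pt_filterlim.
      apply (ex_derive_continuous T). eexists; apply Tderive.
    - rewrite T0, T1, Rmin_left, Rmax_right by lra. exact Hx.
    - rewrite Rmin_left, Rmax_right in Is by lra. exists s; auto. }
  destruct (choice _ ex) as [S HS].
  assert (HT : forall s, 0 <= s <= 1 -> cc01 (T s)).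
  { intros s Hs. pose proof (Tle 0 s). pose proof (Tle s 1). split; lra. }
  exists S. split; [|split; [|split]].
  - intros x; apply HS.
  - intros x; apply HS.
  - intros s Hs. split; [auto|].
    destruct (HS (T s)) as [I1 E1]. specialize (E1 (HT s Hs)).
    destruct (Rtotal_order (S (T s)) s) as [L|[E|L]]; [|exact E|].
    + apply Tincr in L; lra.
    + apply Tincr in L; lra.
  - intros x y Hx Hy L. destruct (HS x) as [Ix Ex], (HS y) as [Iy Ey].
    destruct (Rlt_le_dec (S x) (S y)) as [|Le]; [assumption|].
    apply Tle in Le; [|lra|lra]. rewrite Ex, Ey in Le by assumption. lra.
Qed.

Variable S : R -> R.
Hypothesis SI : forall x, 0 <= S x <= 1.
Hypothesis TS : forall x, cc01 x -> T (S x) = x.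
Hypothesis ST : forall s, 0 <= s <= 1 -> cc01 (T s) /\ S (T s) = s.
Hypothesis Sincr : forall x y, cc01 x -> cc01 y -> x < y -> S x < S y.

(** When [s0 + e] or [s0 - e] leaves the unit interval, the corresponding
    one-sided bound is automatic; this is what handles the end points. *)
Lemma inverse_continue_in (x0 : R) : cc01 x0 -> continue_in S cc01 x0.
Proof.
  intros Hx0 e He. set (s0 := S x0). assert (Is0 := SI x0 : 0 <= s0 <= 1).
  assert (up : exists d, 0 < d /\ forall x, cc01 x -> x - x0 < d -> S x < s0 + e).
  { destruct (Rle_lt_dec (s0 + e) 1) as [L|L].
    - destruct (ST (s0 + e)) as [I E]; [lra|].
      exists (T (s0 + e) - x0). split.
      + pose proof (TS x0 Hx0) as E0. fold s0 in E0.
        pose proof (Tincr s0 (s0 + e)). lra.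
      + intros x Hx Lx. rewrite <- E. apply Sincr; auto; lra.
    - exists 1. split; [lra|]. intros x Hx _. specialize (SI x). lra. }
  assert (dn : exists d, 0 < d /\ forall x, cc01 x -> x0 - x < d -> s0 - e < S x).
  { destruct (Rle_lt_dec 0 (s0 - e)) as [L|L].
    - destruct (ST (s0 - e)) as [I E]; [lra|].
      exists (x0 - T (s0 - e)). split.
      + pose proof (TS x0 Hx0) as E0. fold s0 in E0.
        pose proof (Tincr (s0 - e) s0). lra.
      + intros x Hx Lx. rewrite <- E. apply Sincr; auto; lra.
    - exists 1. split; [lra|]. intros x Hx _. specialize (SI x). lra. }
  destruct up as [d1 [P1 H1]], dn as [d2 [P2 H2]].
  exists (Rmin d1 d2). split; [apply Rmin_pos; assumption|].
  intros x [[Hx _] Dx]. simpl in *. unfold Rdist in *. fold s0.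
  pose proof (Rmin_l d1 d2). pose proof (Rmin_r d1 d2).
  apply Rabs_def2 in Dx.
  specialize (H1 x Hx). specialize (H2 x Hx).
  apply Rabs_def1; lra.
Qed.

(** The difference quotient of the inverse is the reciprocal of a difference
    quotient of [T], composed with the inverse.  Since [T] is differentiable on
    the whole line, the one-sided derivatives at [0] and [1] need no separate
    argument. *)
Lemma inverse_D_in (x0 : R) :
  cc01 x0 -> f (S x0) <> 0 -> D_in S (fun x => / f (S x)) cc01 x0.
Proof.
  intros Hx0 Hf.
  assert (DT : D_in T f no_cond (S x0)).
  { apply derivable_pt_lim_D_in, is_derive_Reals, Tderive. }
  assert (Hne : forall x, cc01 x -> x <> x0 -> S x <> S x0).
  { intros x Hx N E. apply N. rewrite <- (TS x Hx), <- (TS x0 Hx0), E. reflexivity. }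
  pose proof (limit_inv _ _ _ _
    (limit_comp _ _ _ _ _ _ _ (inverse_continue_in x0 Hx0) DT) Hf) as L.
  intros e He. destruct (L e He) as [a [Ha HL]]. exists a. split; [assumption|].
  intros x [[Hx N] Dx]. specialize (HL x).
  rewrite (TS x Hx), (TS x0 Hx0) in HL.
  rewrite Rinv_div in HL. apply HL.
  assert (S x0 <> S x) by (apply not_eq_sym, Hne; auto).
  unfold Dgf, D_x, no_cond. auto.
Qed.

End Inverse.

Definition clamp (s : R) : R := Rmax 0 (Rmin s 1).

Lemma clamp_bounds (s : R) : 0 <= clamp s <= 1.
Proof. unfold clamp, Rmax, Rmin. repeat destruct Rle_dec; lra. Qed.

Lemma clamp_id (s : R) : 0 <= s <= 1 -> clamp s = s.
Proof. unfold clamp, Rmax, Rmin. repeat destruct Rle_dec; lra. Qed.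

Lemma continuous_clamp (s : R) : continuous clamp s.
Proof.
  apply continuity_pt_filterlim, continuity_pt_locally. intros e.
  exists e. intros u Hu. eapply Rle_lt_trans; [|apply Hu].
  unfold abs, minus, plus, opp; simpl. unfold clamp, Rmax, Rmin.
  repeat destruct Rle_dec; unfold Rabs; repeat destruct Rcase_abs; lra.
Qed.

(** The equation [S' = kappa (k S + delta) / W S] with both end values
    prescribed.  Freezing [W] and [k] at their boundary values outside the unit
    interval makes the travel time integrand continuous and nonnegative on the
    whole line.  [W 0 = 0] is permitted: then [S'] is infinite at [0], and the
    equation is only claimed where [W S] does not vanish. *)
Lemma separable_connection (W k : R -> R) (sc K kappa : R) :
  (forall s, continuous W s) -> (forall s, continuous k s) ->
  0 <= W 0 -> (forall s, 0 < s <= 1 -> 0 < W s) ->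
  (forall s, 0 <= s <= 1 -> 0 <= k s) ->
  0 < sc <= 1 -> 0 < K -> (forall s, 0 <= s <= sc -> k s <= K * (sc - s)) ->
  0 < kappa ->
  exists delta (S : R -> R), 0 < delta /\
    S 0 = 0 /\ S 1 = 1 /\
    (forall x, 0 <= S x <= 1) /\
    (forall x y, cc01 x -> cc01 y -> x < y -> S x < S y) /\
    (forall s, 0 <= s <= 1 -> exists x, cc01 x /\ S x = s) /\
    (forall x, cc01 x -> continue_in S cc01 x) /\
    (forall x, cc01 x -> W (S x) <> 0 ->
      D_in S (fun x => kappa * (k (S x) + delta) / W (S x)) cc01 x).
Proof.
  intros HW Hk HW0 HWpos Hk0 Hsc HK Hkle Hkap.
  set (Wc := fun s => W (clamp s)). set (kc := fun s => k (clamp s)).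
  assert (CW : forall s, continuous Wc s)
    by (intros s; apply (continuous_comp clamp); [apply continuous_clamp | auto]).
  assert (Ck : forall s, continuous kc s)
    by (intros s; apply (continuous_comp clamp); [apply continuous_clamp | auto]).
  assert (Wc0 : forall s, 0 <= Wc s).
  { intros s. unfold Wc. destruct (clamp_bounds s) as [[L|E] U].
    - left; auto.
    - rewrite <- E; assumption. }
  assert (kc0 : forall s, 0 <= kc s) by (intros; apply Hk0, clamp_bounds).
  destruct (travel_time_onto Wc kc CW Ck Wc0 kc0 sc K kappa)
    as [delta [Hd ET]]; auto.
  { intros s Hs. unfold Wc. rewrite clamp_id by lra. auto. }
  { intros s Hs. unfold kc. rewrite clamp_id by lra. auto. }
  set (f := fun s => Wc s / (kc s + delta)) in *.
  assert (Cf : forall s, continuous f s)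
    by (intros; apply continuous_div_reg; auto).
  assert (fpos : forall s, 0 < s <= 1 -> 0 < f s).
  { intros s Hs. apply Rdiv_lt_0_compat.
    - unfold Wc. rewrite clamp_id by lra. auto.
    - specialize (kc0 s). lra. }
  set (T := fun s => / kappa * RInt f 0 s).
  assert (T0 : T 0 = 0).
  { unfold T. rewrite RInt_point. unfold zero; simpl. ring. }
  assert (T1 : T 1 = 1).
  { unfold T. rewrite ET. field. lra. }
  assert (Td : forall s, is_derive T s (/ kappa * f s)).
  { intros s. apply (is_derive_scal (fun s => RInt f 0 s) s (/ kappa)).
    apply (is_derive_RInt (V := R_CompleteNormedModule) f _ 0); auto.
    exists (mkposreal 1 Rlt_0_1). intros y _.
    apply (RInt_correct (V := R_CompleteNormedModule)), ex_RInt_cont; auto. }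
  assert (Tincr : forall s t, 0 <= s -> s < t -> t <= 1 -> T s < T t).
  { intros s t Hs L Ht. unfold T. apply Rmult_lt_compat_l.
    - apply Rinv_0_lt_compat; assumption.
    - rewrite (RInt_Chasles_R f 0 s t) by auto.
      assert (0 < RInt f s t); [|lra].
      apply RInt_gt_0; auto. intros x Hx. apply fpos. lra. }
  destruct (inverse_of_increasing T _ T0 T1 Td Tincr) as [S [SI [TS [ST Si]]]].
  exists delta, S. split; [assumption|]. split; [|split].
  { rewrite <- T0 at 1. apply ST. lra. }
  { rewrite <- T1 at 1. apply ST. lra. }
  split; [exact SI|]. split; [exact Si|]. split.
  { intros s Hs. exists (T s). apply ST, Hs. }
  split.
  { apply (inverse_continue_in T Tincr S); auto. }
  intros x Hx HWx.
  assert (Hkx : 0 < k (S x) + delta) by (specialize (Hk0 (S x) (SI x)); lra).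
  assert (Ef : / kappa * f (S x) = / (kappa * (k (S x) + delta) / W (S x))).
  { unfold f, Wc, kc. rewrite clamp_id by apply SI. field. repeat split; lra. }
  assert (Hne : / kappa * f (S x) <> 0).
  { rewrite Ef. apply Rinv_neq_0_compat. unfold Rdiv.
    repeat apply Rmult_integral_contrapositive_currified; try lra.
    apply Rinv_neq_0_compat; assumption. }
  pose proof (inverse_D_in T _ Td Tincr S SI TS ST Si x Hx Hne) as D.
  unfold D_in in D |- *. simpl in D. rewrite Ef, Rinv_inv in D. exact D.
Qed.

(** * Calculus along a solution of an autonomous equation *)

Lemma D_in_ext (f d d' : R -> R) (J : R -> Prop) (x : R) :
  D_in f d J x -> d x = d' x -> D_in f d' J x.
Proof. unfold D_in. intros H <-. exact H. Qed.

Lemma D_in_congr (f f' d : R -> R) (J : R -> Prop) (x : R) :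
  (forall y, f y = f' y) -> D_in f d J x -> D_in f' d J x.
Proof.
  intros E H e He. destruct (H e He) as [a [Ha K]]. exists a. split; [assumption|].
  intros y Hy. rewrite <- !E. apply K, Hy.
Qed.

Lemma D_in_subset (f d : R -> R) (J J' : R -> Prop) (x : R) :
  (forall y, J' y -> J y) -> D_in f d J x -> D_in f d J' x.
Proof. intros H. apply limit1_imp. unfold D_x. intuition. Qed.

Lemma D_in_comp (J : R -> Prop) (P dP phi : R -> R) (l x : R) :
  D_in P dP J x -> is_derive phi (P x) l ->
  D_in (fun y => phi (P y)) (fun _ => l * dP x) J x.
Proof.
  intros HP Hphi.
  assert (Hphi' : D_in phi (fun _ => l) no_cond (P x))
    by (apply derivable_pt_lim_D_in, is_derive_Reals, Hphi).
  apply D_in_ext with (fun y => dP y * l); [|apply Rmult_comm].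
  pose proof (Dcomp _ _ _ _ _ _ _ HP Hphi') as D.
  apply (D_in_subset _ _ _ J) in D; [exact D|].
  unfold Dgf, no_cond. auto.
Qed.

(** If [P' = g P], then every derivative of [phi P] is again a function of [P]:
    the first is [(phi' g) P] and the second is [((phi' g)' g) P].  So [C2]
    regularity relative to [J] follows from regularity of [g] and [phi] at the
    values of [P]. *)
Lemma C2_on_comp (J : R -> Prop) (P g dg phi dphi ddphi : R -> R) :
  (forall x, J x -> D_in P (fun y => g (P y)) J x) ->
  (forall x, J x -> is_derive g (P x) (dg (P x)) /\ ex_derive dg (P x)) ->
  (forall x, J x -> is_derive phi (P x) (dphi (P x)) /\
     is_derive dphi (P x) (ddphi (P x)) /\ ex_derive ddphi (P x)) ->
  C2_on J (fun x => phi (P x)).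
Proof.
  intros HP Hg Hphi.
  set (h := fun p => ddphi p * g p + dphi p * dg p).
  exists (fun x => dphi (P x) * g (P x)), (fun x => h (P x) * g (P x)).
  intros x Hx. specialize (HP x Hx). specialize (Hg x Hx). specialize (Hphi x Hx).
  destruct Hg as [Dg Edg], Hphi as [D1 [D2 E3]].
  assert (Eg : ex_derive g (P x)) by (eexists; exact Dg).
  assert (E1 : ex_derive dphi (P x)) by (eexists; exact D2).
  split; [|split].
  - eapply D_in_ext; [apply (D_in_comp J P _ phi _ x HP D1)|]. reflexivity.
  - eapply D_in_ext.
    + apply (D_in_comp J P _ (fun p => dphi p * g p) (h (P x)) x HP).
      apply (is_derive_mult dphi g (P x) _ _ D2 Dg). intros; apply Rmult_comm.
    + reflexivity.
  - assert (Eh : ex_derive (fun p => h p * g p) (P x)).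
    { unfold h.
      apply (ex_derive_mult (fun p => ddphi p * g p + dphi p * dg p) g); [|assumption].
      apply (ex_derive_plus (fun p => ddphi p * g p) (fun p => dphi p * dg p));
        [apply (ex_derive_mult ddphi g) | apply (ex_derive_mult dphi dg)];
        assumption. }
    destruct Eh as [l Hl].
    apply (cont_deriv _ (fun _ => l * g (P x))).
    apply (D_in_comp J P _ (fun p => h p * g p) l x HP Hl).
Qed.

Lemma continue_in_comp (J : R -> Prop) (P phi : R -> R) (x : R) :
  continue_in P J x -> ex_derive phi (P x) ->
  continue_in (fun y => phi (P y)) J x.
Proof.
  intros HP Hphi e He.
  apply (ex_derive_continuous phi), continuity_pt_filterlim in Hphi.
  destruct (proj1 (continuity_pt_locally phi (P x)) Hphi (mkposreal e He)) as [d Hd].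
  destruct (HP d (cond_pos d)) as [a [Ha H]].
  exists a. split; [assumption|]. intros y Hy. apply Hd, (H y Hy).
Qed.

(** * The pressure profile *)

Section PressureProfile.
Variables A ps p1 pe kappa : R.
Hypothesis Hps : ps < p1 <= A / 2.
Hypothesis Hkap : 0 < kappa.

(** Both directions at once: [sigma] is the sign of [pe - p1], and [c] is the
    distance from [ps] at which the right-hand side degenerates, so that
    [lam = c^2 + sigma delta]. *)
Lemma pressure_connection (sigma c sc K : R) :
  sigma ^ 2 = 1 -> 0 < sigma * (pe - p1) -> pe < A / 2 ->
  0 < sc <= 1 -> 0 < K ->
  (forall s, 0 <= s <= 1 ->
     0 <= sigma * (c ^ 2 - (p1 + s * (pe - p1) - ps) ^ 2)) ->
  (forall s, 0 <= s <= sc ->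
     sigma * (c ^ 2 - (p1 + s * (pe - p1) - ps) ^ 2) <= K * (sc - s)) ->
  exists lam (P : R -> R),
    P 0 = p1 /\ P 1 = pe /\
    (forall x, Rmin p1 pe <= P x <= Rmax p1 pe) /\
    (forall x, oc01 x -> P x < A / 2) /\
    (forall x, cc01 x -> continue_in P cc01 x) /\
    (forall x, cc01 x -> P x <> A / 2 ->
      D_in P (fun y => kappa * (lam - (P y - ps) ^ 2) / (A - 2 * P y)) cc01 x) /\
    (forall p, Rmin p1 pe <= p <= Rmax p1 pe ->
      exists xh, cc01 xh /\ P xh = p) /\
    (forall x y, cc01 x -> cc01 y -> x < y -> sigma * P x < sigma * P y).
Proof.
  intros Hs HD HpeA Hsc HK Hk0 Hkle.
  set (D := pe - p1) in *.
  assert (Hs0 : sigma <> 0) by nra. assert (HD0 : D <> 0) by nra.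
  set (k := fun s => sigma * (c ^ 2 - (p1 + s * D - ps) ^ 2)).
  set (W := fun s => (A - 2 * (p1 + s * D)) * (sigma * D)).
  destruct (separable_connection W k sc K kappa)
    as [delta [S [Hd [S0 [S1 [SI [Si [So [Sc SD]]]]]]]]]; auto.
  - intros s. apply (ex_derive_continuous W). unfold W. auto_derive. exact I.
  - intros s. apply (ex_derive_continuous k). unfold k. auto_derive. exact I.
  - unfold W. apply Rmult_le_pos; lra.
  - intros s I. unfold W. apply Rmult_lt_0_compat; [|assumption].
    replace (A - 2 * (p1 + s * D)) with ((1 - s) * (A - 2 * p1) + s * (A - 2 * pe))
      by (unfold D; ring).
    assert (0 <= (1 - s) * (A - 2 * p1)) by (apply Rmult_le_pos; lra).
    assert (0 < s * (A - 2 * pe)) by (apply Rmult_lt_0_compat; lra). lra.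
  - set (P := fun x => p1 + S x * D).
    exists (c ^ 2 + sigma * delta), P.
    split; [unfold P; rewrite S0; ring|].
    split; [unfold P; rewrite S1; unfold D; ring|].
    split; [|split; [|split; [|split; [|split]]]].
    + intros x. specialize (SI x). unfold P, D in *.
      unfold Rmin, Rmax; destruct Rle_dec; nra.
    (* p1 = A / 2 is possible, but pe < A / 2 and S x > 0. *)
    + intros x [Hx0 Hx1]. assert (0 < S x).
      { rewrite <- S0. apply Si; unfold cc01; lra. }
      specialize (SI x). unfold P, D. nra.
    + intros x Hx e He.
      destruct (Sc x Hx (e / Rabs D)) as [a [Ha H]].
      { apply Rdiv_lt_0_compat; [assumption|apply Rabs_pos_lt; assumption]. }
      exists a. split; [assumption|]. intros y Hy. specialize (H y Hy).
      simpl in H |- *. unfold Rdist in *. unfold P.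
      replace (p1 + S y * D - (p1 + S x * D)) with ((S y - S x) * D) by ring.
      rewrite Rabs_mult. apply Rlt_div_r; [apply Rabs_pos_lt; assumption|assumption].
    + intros x Hx HP.
      assert (A - 2 * P x <> 0) by lra.
      assert (HW : W (S x) <> 0).
      { unfold W. apply Rmult_integral_contrapositive_currified; [assumption|lra]. }
      eapply D_in_ext.
      * apply (D_in_comp cc01 S _ (fun s => p1 + s * D) D x (SD x Hx HW)).
        auto_derive; [exact I|ring].
      * simpl. unfold W, k. fold (P x).
        (* W contains the factor sigma * D = |D|, and sigma is its own inverse. *)
        assert (Es : / sigma = sigma).
        { apply Rmult_eq_reg_l with sigma; [|assumption].
          rewrite Rinv_r by assumption. lra. }
        transitivity (kappa * (sigma * (c ^ 2 - (P x - ps) ^ 2) + delta) * / sigma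
                       / (A - 2 * P x)).
        { unfold P. field. fold (P x). repeat split; auto. }
        rewrite Es. f_equal.
        replace (kappa * (sigma * (c ^ 2 - (P x - ps) ^ 2) + delta) * sigma)
          with (kappa * (sigma ^ 2 * (c ^ 2 - (P x - ps) ^ 2) + sigma * delta)) by ring.
        rewrite Hs. ring.
    + intros p Hp. destruct (So ((p - p1) / D)) as [x [Ix Ex]].
      { assert (D < 0 \/ 0 < D) as [L|L] by lra; unfold D in *.
        - rewrite Rmin_right, Rmax_left in Hp by lra.
          replace ((p - p1) / (pe - p1)) with ((p1 - p) / (p1 - pe)) by (field; lra).
          split; [apply Rdiv_le_0_compat; lra | apply Rle_div_l; lra].
        - rewrite Rmin_left, Rmax_right in Hp by lra.
          split; [apply Rdiv_le_0_compat; lra | apply Rle_div_l; lra]. }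
      exists x. split; [assumption|]. unfold P. rewrite Ex. field. assumption.
    + intros x y Hx Hy L. specialize (Si x y Hx Hy L). unfold P. nra.
Qed.

(** If [pe < ps], then [(p - ps)^2] has its minimum [0] at the sonic pressure,
    reached at [sc = (p1 - ps) / (p1 - pe)]; otherwise the critical value is
    [(pe - ps)^2], reached at [s = 1]. *)
Lemma pressure_profile :
  pe < ps \/ ps < pe < p1 \/ p1 < pe < A / 2 ->
  exists lam (P : R -> R),
    P 0 = p1 /\ P 1 = pe /\
    (forall x, Rmin p1 pe <= P x <= Rmax p1 pe) /\
    (forall x, oc01 x -> P x < A / 2) /\
    (forall x, cc01 x -> continue_in P cc01 x) /\
    (forall x, cc01 x -> P x <> A / 2 ->
      D_in P (fun y => kappa * (lam - (P y - ps) ^ 2) / (A - 2 * P y)) cc01 x) /\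
    (pe < ps -> exists xh, 0 < xh < 1 /\ forall x, cc01 x ->
       (x < xh -> ps < P x) /\ (xh < x -> P x < ps)).
Proof.
  intros [C|[C|C]].
  - set (sc := (p1 - ps) / (p1 - pe)).
    assert (Esc : sc * (p1 - pe) = p1 - ps) by (unfold sc; field; lra).
    assert (Hsc : 0 < sc <= 1).
    { split; [apply Rdiv_lt_0_compat; lra | apply Rle_div_l; lra]. }
    assert (Ey : forall s, p1 + s * (pe - p1) - ps = (sc - s) * (p1 - pe)).
    { intros s. replace ((sc - s) * (p1 - pe)) with (sc * (p1 - pe) - s * (p1 - pe)) by ring.
      rewrite Esc. ring. }
    destruct (pressure_connection (-1) 0 sc ((p1 - pe) ^ 2))
      as [lam [P [P0 [P1 [PI [PA [Pc [PD [Po Pm]]]]]]]]]; try lra; auto.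
    + apply pow_lt; lra.
    + intros s Is. rewrite Ey. pose proof (pow2_ge_0 ((sc - s) * (p1 - pe))). lra.
    + intros s Is. rewrite Ey.
      pose proof (pow2_ge_0 (p1 - pe)).
      assert ((sc - s) ^ 2 <= sc - s) by nra.
      rewrite Rpow_mult_distr. nra.
    + exists lam, P. do 6 (split; [assumption|]). intros _.
      destruct (Po ps) as [xh [Ih Eh]].
      { rewrite Rmin_right, Rmax_left by lra. lra. }
      exists xh. split.
      { destruct Ih as [I0 I1]. split.
        - destruct I0 as [|E]; [assumption|]. rewrite <- E in Eh. lra.
        - destruct I1 as [|E]; [assumption|]. rewrite E in Eh. lra. }
      intros x Hx. rewrite <- Eh.
      split; intros L; [specialize (Pm x xh Hx Ih L) | specialize (Pm xh x Ih Hx L)];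
        lra.
  - destruct (pressure_connection (-1) (pe - ps) 1 ((p1 - pe) * (2 * (p1 - ps))))
      as [lam [P [P0 [P1 [PI [PA [Pc [PD [Po Pm]]]]]]]]]; try lra.
    + apply Rmult_lt_0_compat; lra.
    + intros s Is.
      replace (-1 * ((pe - ps) ^ 2 - (p1 + s * (pe - p1) - ps) ^ 2))
        with ((1 - s) * (p1 - pe) * ((1 - s) * (p1 - pe) + 2 * (pe - ps))) by ring.
      assert (0 <= (1 - s) * (p1 - pe)) by (apply Rmult_le_pos; lra).
      apply Rmult_le_pos; lra.
    + intros s Is.
      replace (-1 * ((pe - ps) ^ 2 - (p1 + s * (pe - p1) - ps) ^ 2))
        with ((1 - s) * (p1 - pe) * ((1 - s) * (p1 - pe) + 2 * (pe - ps))) by ring.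
      assert (0 <= (1 - s) * (p1 - pe)) by (apply Rmult_le_pos; lra).
      assert (0 <= s * (p1 - pe)) by (apply Rmult_le_pos; lra).
      replace ((p1 - pe) * (2 * (p1 - ps)) * (1 - s))
        with ((1 - s) * (p1 - pe) * (2 * (p1 - ps))) by ring.
      apply Rmult_le_compat_l; lra.
    + exists lam, P. do 6 (split; [assumption|]). intros; lra.
  - destruct (pressure_connection 1 (pe - ps) 1 ((pe - p1) * (2 * (pe - ps))))
      as [lam [P [P0 [P1 [PI [PA [Pc [PD [Po Pm]]]]]]]]]; try lra.
    + apply Rmult_lt_0_compat; lra.
    + intros s Is.
      replace (1 * ((pe - ps) ^ 2 - (p1 + s * (pe - p1) - ps) ^ 2))
        with ((1 - s) * (pe - p1) * (2 * (pe - ps) - (1 - s) * (pe - p1))) by ring.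
      assert (0 <= (1 - s) * (pe - p1)) by (apply Rmult_le_pos; lra).
      assert (0 <= s * (pe - p1)) by (apply Rmult_le_pos; lra).
      apply Rmult_le_pos; lra.
    + intros s Is.
      replace (1 * ((pe - ps) ^ 2 - (p1 + s * (pe - p1) - ps) ^ 2))
        with ((1 - s) * (pe - p1) * (2 * (pe - ps) - (1 - s) * (pe - p1))) by ring.
      assert (0 <= (1 - s) * (pe - p1)) by (apply Rmult_le_pos; lra).
      replace ((pe - p1) * (2 * (pe - ps)) * (1 - s))
        with ((1 - s) * (pe - p1) * (2 * (pe - ps))) by ring.
      apply Rmult_le_compat_l; lra.
    + exists lam, P. do 6 (split; [assumption|]). intros; lra.
Qed.

End PressureProfile.

(** * Gas states with given mass and momentum flux *)

Lemma mach_lt_1 (gamma : R) (U : state) :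
  1 < gamma -> positive_state U ->
  (mach gamma U < 1 <-> dens U * vel U ^ 2 < gamma * pres U).
Proof.
  intros Hg [Hu [Hr Hp]]. unfold mach.
  assert (H0 : 0 < gamma * pres U / dens U) by (apply Rdiv_lt_0_compat; nra).
  assert (Hc := sqrt_lt_R0 _ H0).
  rewrite Rabs_pos_eq by lra.
  assert (E : dens U * sqrt (gamma * pres U / dens U) ^ 2 = gamma * pres U).
  { rewrite pow2_sqrt by lra. field. lra. }
  set (c := sqrt _) in *. rewrite <- E. split; intros H.
  - apply Rlt_div_l in H; [|lra]. apply Rmult_lt_compat_l; [lra|]. nra.
  - apply Rlt_div_l; [lra|]. apply Rmult_lt_reg_l in H; [|lra]. nra.
Qed.

Lemma mach_gt_1 (gamma : R) (U : state) :
  1 < gamma -> positive_state U ->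
  (1 < mach gamma U <-> gamma * pres U < dens U * vel U ^ 2).
Proof.
  intros Hg [Hu [Hr Hp]]. unfold mach.
  assert (H0 : 0 < gamma * pres U / dens U) by (apply Rdiv_lt_0_compat; nra).
  assert (Hc := sqrt_lt_R0 _ H0).
  rewrite Rabs_pos_eq by lra.
  assert (E : dens U * sqrt (gamma * pres U / dens U) ^ 2 = gamma * pres U).
  { rewrite pow2_sqrt by lra. field. lra. }
  set (c := sqrt _) in *. rewrite <- E. split; intros H.
  - apply Rlt_div_r in H; [|lra]. apply Rmult_lt_compat_l; [lra|]. nra.
  - apply Rlt_div_r; [lra|]. apply Rmult_lt_reg_l in H; [|lra]. nra.
Qed.

Section GasState.
Variables gamma A m : R.
Hypothesis Hgamma : 1 < gamma.
Hypothesis Hm : 0 < m.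

Definition gas_state (p : R) : state := mkState ((A - p) / m) (m ^ 2 / (A - p)) p.

Lemma gas_state_flux (p : R) :
  p < A ->
  dens (gas_state p) * vel (gas_state p) = m /\
  dens (gas_state p) * vel (gas_state p) ^ 2 + pres (gas_state p) = A.
Proof. intros Hp. simpl. split; field; split; lra. Qed.

Lemma gas_state_positive (p : R) : 0 < p < A -> positive_state (gas_state p).
Proof.
  intros Hp. repeat split; simpl; try apply Rdiv_lt_0_compat; nra.
Qed.

Lemma gas_state_subsonic (p : R) :
  0 < p < A -> (mach gamma (gas_state p) < 1 <-> A / (gamma + 1) < p).
Proof.
  intros Hp. rewrite mach_lt_1 by auto using gas_state_positive.
  destruct (gas_state_flux p (proj2 Hp)) as [_ E]. change (pres (gas_state p)) with p in *.
  rewrite (Rlt_div_l A p (gamma + 1)) by lra. split; intros; lra.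
Qed.

Lemma gas_state_supersonic (p : R) :
  0 < p < A -> (1 < mach gamma (gas_state p) <-> p < A / (gamma + 1)).
Proof.
  intros Hp. rewrite mach_gt_1 by auto using gas_state_positive.
  destruct (gas_state_flux p (proj2 Hp)) as [_ E]. change (pres (gas_state p)) with p in *.
  rewrite <- (Rlt_div_r p A (gamma + 1)) by lra. split; intros; lra.
Qed.

Lemma gas_state_unique (U : state) :
  positive_state U -> dens U * vel U = m -> dens U * vel U ^ 2 + pres U = A ->
  U = gas_state (pres U).
Proof.
  destruct U as [u r p]; unfold positive_state, gas_state; simpl.
  intros [Hu [Hr Hp]] Em EA.
  assert (E : A - p = m * u) by (rewrite <- Em, <- EA; ring).
  rewrite E. f_equal.
  - field. lra.
  - rewrite <- Em at 1. rewrite <- Em. field. split; lra.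
Qed.

(** Completing the square: the vertex of the enthalpy parabola is the sonic
    pressure. *)
Lemma gas_state_enthalpy (p : R) :
  0 < A -> p < A ->
  total_enthalpy gamma (gas_state p) =
    total_enthalpy gamma (gas_state (A / (gamma + 1)))
    - (gamma + 1) / (2 * (gamma - 1) * m ^ 2) * (p - A / (gamma + 1)) ^ 2.
Proof.
  intros HA Hp. unfold total_enthalpy; simpl. field.
  repeat split; try lra.
  replace (A * (gamma + 1) - A) with (A * gamma) by ring.
  apply Rmult_integral_contrapositive_currified; lra.
Qed.

(** With [kappa = (gamma + 1) m / (2 eps)], the scalar equation says that
    [e' = kappa (lam - (p - ps)^2) / ((gamma - 1) m^2)], because [de/dp] is
    [(A - 2 p) / ((gamma - 1) m^2)].  By [gas_state_enthalpy] the right-hand side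
    differs from [m Phi / eps] by a constant, which is the integrated energy
    equation. *)
Lemma gas_state_solution (eps lam : R) (J : R -> Prop) (P : R -> R) :
  0 < A -> 0 < eps ->
  (forall x, P x < A) ->
  (forall x, J x -> 0 < P x /\ P x <> A / 2) ->
  (forall x, J x ->
     D_in P (fun y => (gamma + 1) * m / (2 * eps)
        * (lam - (P y - A / (gamma + 1)) ^ 2) / (A - 2 * P y)) J x) ->
  steady_solution gamma eps J (fun x => gas_state (P x)).
Proof.
  intros HA Heps HPA HPJ HD.
  set (ps := A / (gamma + 1)) in *.
  set (kappa := (gamma + 1) * m / (2 * eps)) in *.
  set (g := fun p => kappa * (lam - (p - ps) ^ 2) / (A - 2 * p)).
  set (dg := fun p => kappa * (-2 * (p - ps) * (A - 2 * p) + 2 * (lam - (p - ps) ^ 2))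
                      / (A - 2 * p) ^ 2).
  change (forall x, J x -> D_in P (fun y => g (P y)) J x) in HD.
  assert (Hg : forall x, J x -> is_derive g (P x) (dg (P x)) /\ ex_derive dg (P x)).
  { intros x Hx. destruct (HPJ x Hx) as [_ N].
    assert (A - 2 * P x <> 0) by lra.
    split; unfold g, dg; auto_derive.
    - assumption.
    - field. assumption.
    - apply (pow_nonzero _ 2). assumption. }
  assert (HAP : forall x, A - P x <> 0) by (intros x; specialize (HPA x); lra).
  split; [|split; [|split; [|split]]].
  - split; [|split].
    + apply (C2_on_comp J P g dg (fun p => (A - p) / m) (fun _ => - / m) (fun _ => 0));
        [assumption | assumption |].
      intros x Hx. split; [|split]; auto_derive; try exact I; field; lra.
    + apply (C2_on_comp J P g dg (fun p => m ^ 2 / (A - p))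
               (fun p => m ^ 2 / (A - p) ^ 2) (fun p => 2 * m ^ 2 / (A - p) ^ 3));
        [assumption | assumption |].
      intros x Hx. specialize (HAP x).
      split; [|split]; auto_derive.
      * assumption.
      * field. assumption.
      * apply (pow_nonzero _ 2 HAP).
      * field. assumption.
      * apply (pow_nonzero _ 3 HAP).
    + apply (C2_on_comp J P g dg (fun p => p) (fun _ => 1) (fun _ => 0));
        [assumption | assumption |].
      intros x Hx. split; [|split]; auto_derive; try exact I; ring.
  - intros x Hx. destruct (HPJ x Hx) as [Hp _].
    split; apply (gas_state_positive (P x)); auto.
  - intros x Hx. apply D_in_congr with (fun _ => m).
    + intros y. symmetry. apply gas_state_flux, HPA.
    + apply Dconst.
  - intros x Hx. apply D_in_congr with (fun _ => A).
    + intros y. symmetry. apply gas_state_flux, HPA.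
    + apply Dconst.
  - exists (fun x => kappa * (lam - (P x - ps) ^ 2) / ((gamma - 1) * m ^ 2)),
      (fun x => - 2 * kappa * (P x - ps) / ((gamma - 1) * m ^ 2) * g (P x)).
    intros x Hx. specialize (HD x Hx). destruct (HPJ x Hx) as [Hp N].
    split; [|split].
    + eapply D_in_ext.
      * apply (D_in_comp J P _ (fun p => internal_energy gamma (gas_state p))
                 ((A - 2 * P x) / ((gamma - 1) * m ^ 2)) x HD).
        apply is_derive_ext_loc with (fun p => p * (A - p) / ((gamma - 1) * m ^ 2)).
        -- assert (Hr : 0 < A - P x) by (specialize (HPA x); lra).
           exists (mkposreal _ Hr). intros y Hy.
           assert (Hy' : Rabs (y - P x) < A - P x) by apply Hy.
           apply Rabs_def2 in Hy'.
           unfold internal_energy; simpl. field. repeat split; lra.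
        -- auto_derive; [exact I|]. field. lra.
      * unfold g; simpl. field. repeat split; lra.
    + eapply D_in_ext.
      * apply (D_in_comp J P _
                 (fun p => kappa * (lam - (p - ps) ^ 2) / ((gamma - 1) * m ^ 2))
                 (- 2 * kappa * (P x - ps) / ((gamma - 1) * m ^ 2)) x HD).
        auto_derive; [exact I|]. field. lra.
      * reflexivity.
    + apply D_in_congr with (fun y => m * (total_enthalpy gamma (gas_state ps)
          - (gamma + 1) / (2 * (gamma - 1) * m ^ 2) * (P y - ps) ^ 2)).
      { intros y. unfold ps. rewrite <- gas_state_enthalpy by auto.
        f_equal. symmetry. apply gas_state_flux, HPA. }
      eapply D_in_ext.
      * apply (D_in_comp J P _ (fun p => m * (total_enthalpy gamma (gas_state ps)
          - (gamma + 1) / (2 * (gamma - 1) * m ^ 2) * (p - ps) ^ 2))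
          (- (gamma + 1) / ((gamma - 1) * m) * (P x - ps)) x HD).
        auto_derive; [exact I|]. field. lra.
      * simpl. unfold kappa. field. lra.
Qed.

(** Two distinct points at equal height on a parabola are symmetric about its
    vertex. *)
Lemma conjugate_pressures (p0 p1 : R) :
  0 < A -> p0 < A -> p1 < A ->
  total_enthalpy gamma (gas_state p0) = total_enthalpy gamma (gas_state p1) ->
  p0 <> p1 -> p0 + p1 = 2 * (A / (gamma + 1)).
Proof.
  intros HA H0 H1 E N.
  rewrite (gas_state_enthalpy p0), (gas_state_enthalpy p1) in E by assumption.
  set (b := (gamma + 1) / (2 * (gamma - 1) * m ^ 2)) in *.
  assert (Hb : 0 < b) by (apply Rdiv_lt_0_compat; [lra|]; apply Rmult_lt_0_compat; nra).
  set (ps := A / (gamma + 1)) in *.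
  assert (E' : b * (p0 - p1) * (p0 + p1 - 2 * ps) = 0) by nra.
  apply Rmult_integral in E' as [E'|E']; [|lra].
  apply Rmult_integral in E' as [E'|E']; lra.
Qed.

(** The left-hand side is the pressure conjugate to [p0].  The claim is equivalent
    to [A (3 - gamma) <= 2 (gamma + 1) p0], where [A = (1 + gamma M0^2) p0]: it is
    trivial for [gamma >= 3], and for [gamma < 3] it is the stated upper bound on
    [M0^2]. *)
Lemma conjugate_pressure_le_half (p0 M0sq : R) :
  0 < p0 -> M0sq * (gamma * p0) = A - p0 ->
  (1 < gamma < 3 /\ M0sq <= (3 * gamma - 1) / (gamma * (3 - gamma))) \/
    (3 <= gamma /\ 0 < A) ->
  2 * (A / (gamma + 1)) - p0 <= A / 2.
Proof.
  intros Hp0 EM H.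
  cut (A * (3 - gamma) <= 2 * (gamma + 1) * p0).
  { intros L.
    replace (2 * (A / (gamma + 1)) - p0) with
      (A / 2 + (A * (3 - gamma) - 2 * (gamma + 1) * p0) / (2 * (gamma + 1)))
      by (field; lra).
    assert ((A * (3 - gamma) - 2 * (gamma + 1) * p0) / (2 * (gamma + 1)) <= 0);
      [|lra].
    apply Rle_div_l; lra. }
  destruct H as [[Hg HM]|[Hg HA]].
  - assert (Hd : 0 < gamma * (3 - gamma)) by nra.
    apply Rle_div_r in HM; [|assumption].
    replace (A * (3 - gamma))
      with ((M0sq * (gamma * (3 - gamma)) + (3 - gamma)) * p0)
      by (replace A with (M0sq * (gamma * p0) + p0) by lra; ring).
    apply Rmult_le_compat_r; lra.
  - nra.
Qed.

End GasState.

(** * The boundary value problem *)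

(* If M0^2 = (3 gamma - 1) / (gamma (3 - gamma)), then p1 = A/2.  Since
   e is proportional to p (A - p) along a solution, de/dp vanishes at x = 0, and
   no solution that is C^2 up to x = 0 reaches p_e < A/2: the pressure behaves
   like A/2 - c sqrt x.  In that case C^2 regularity and the equations are
   asserted on (0,1], with continuity on [0,1]; otherwise on all of [0,1]. *)
Theorem theorem1p9 (gamma q0 rho0 p0 q1 rho1 p1 : R)
    (Hgamma : 1 < gamma)
    (HU0 : positive_state (mkState q0 rho0 p0)) :
  let M0 := sqrt (rho0 * q0 ^ 2 / (gamma * p0)) in
  let pstar := (p0 + p1) / 2 in
  let A := rho0 * q0 ^ 2 + p0 in
  forall
    (HM0 : 1 < M0)
    (HS : (1 < gamma < 3 /\
           1 < M0 ^ 2 <= (3 * gamma - 1) / (gamma * (3 - gamma))) \/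
          (3 <= gamma /\ 1 < M0))
    (HU1 : positive_state (mkState q1 rho1 p1))
    (HRH : rankine_hugoniot gamma (mkState q0 rho0 p0) (mkState q1 rho1 p1))
    (Hsub : mach gamma (mkState q1 rho1 p1) < 1)
    (eps pe : R)
    (Heps : 0 < eps)
    (Hpe : 0 < pe < pstar \/ pstar < pe < p1 \/ p1 < pe < A / 2),
  exists U : R -> state,
    U 0 = mkState q1 rho1 p1 /\
    pres (U 1) = pe /\
    (p1 <> A / 2 -> steady_solution gamma eps cc01 U) /\
    (p1 = A / 2 -> C0_state_on cc01 U /\ steady_solution gamma eps oc01 U) /\
    (0 < pe < pstar -> transonic_flow gamma U) /\
    (pstar < pe < p1 \/ p1 < pe < A / 2 -> subsonic_flow gamma U).
Proof.
  intros M0 pstar A HM0 HS HU1 HRH Hsub eps pe Heps Hpe.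
  pose proof HU0 as (Hq0 & Hr0 & Hp0). pose proof HU1 as (Hq1 & Hr1 & Hp1).
  destruct HRH as (Emass & Emom & Eenth). cbn [vel dens pres] in *.
  set (m := rho0 * q0).
  assert (Hm : 0 < m) by (apply Rmult_lt_0_compat; assumption).
  assert (EA0 : rho0 * q0 ^ 2 + p0 = A) by reflexivity.
  assert (EA1 : rho1 * q1 ^ 2 + p1 = A) by (symmetry; exact Emom).
  assert (Hp0A : p0 < A) by (assert (0 < rho0 * q0 ^ 2) by (apply Rmult_lt_0_compat; nra); lra).
  assert (Hp1A : p1 < A) by (assert (0 < rho1 * q1 ^ 2) by (apply Rmult_lt_0_compat; nra); lra).
  assert (HA : 0 < A) by lra.
  assert (G0 : mkState q0 rho0 p0 = gas_state A m p0)
    by (apply (gas_state_unique A m Hm (mkState q0 rho0 p0)); auto).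
  assert (G1 : mkState q1 rho1 p1 = gas_state A m p1)
    by (apply (gas_state_unique A m Hm (mkState q1 rho1 p1)); auto).
  set (ps := A / (gamma + 1)).
  assert (L1 : ps < p1) by (rewrite G1 in Hsub; apply gas_state_subsonic in Hsub; auto).
  assert (EM : M0 ^ 2 = (A - p0) / (gamma * p0)).
  { unfold M0. rewrite pow2_sqrt.
    - f_equal. lra.
    - apply Rdiv_le_0_compat; nra. }
  assert (EM' : M0 ^ 2 * (gamma * p0) = A - p0) by (rewrite EM; field; lra).
  assert (HM2 : 1 < M0 ^ 2) by nra.
  assert (L0 : p0 < ps).
  { unfold ps. apply Rlt_div_r; [lra|].
    assert (0 < gamma * p0) by nra. nra. }
  assert (Eps : p0 + p1 = 2 * ps).
  { apply (conjugate_pressures gamma A m); auto; [|lra].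
    rewrite <- G0, <- G1. exact Eenth. }
  assert (Epstar : pstar = ps) by (unfold pstar; lra).
  assert (Hhalf : p1 <= A / 2).
  { replace p1 with (2 * ps - p0) by lra.
    apply (conjugate_pressure_le_half gamma A Hgamma p0 (M0 ^ 2)); auto.
    destruct HS as [[? [_ ?]]|[? _]]; auto. }
  set (kappa := (gamma + 1) * m / (2 * eps)).
  assert (Hkap : 0 < kappa) by (apply Rdiv_lt_0_compat; nra).
  rewrite Epstar in *.
  destruct (pressure_profile A ps p1 pe kappa)
    as [lam [P [P0 [P1 [PI [PA [Pc [PD Pt]]]]]]]]; auto.
  { destruct Hpe as [[_ ?]|[?|?]]; auto. }
  assert (Ipos : forall x, 0 < P x <= A / 2).
  { intros x. specialize (PI x). unfold Rmin, Rmax in PI.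
    destruct (Rle_dec p1 pe); lra. }
  assert (IA : forall x, 0 < P x < A) by (intros x; specialize (Ipos x); lra).
  assert (Dsub : forall J : R -> Prop, (forall x, J x -> cc01 x) ->
    (forall x, J x -> P x <> A / 2) ->
    steady_solution gamma eps J (fun x => gas_state A m (P x))).
  { intros J HJ HN. apply (gas_state_solution gamma A m) with lam; auto.
    - intros; apply IA.
    - intros x Hx. split; [apply IA | auto].
    - intros x Hx. apply D_in_subset with cc01; [exact HJ|]. apply PD; auto. }
  exists (fun x => gas_state A m (P x)).
  split; [rewrite P0; auto|]. split; [exact P1|].
  split; [|split; [|split]].
  - intros N. apply Dsub; [auto|]. intros x [Hx0 Hx1].
    destruct Hx0 as [Hx0|<-]; [|lra].
    specialize (PA x (conj Hx0 Hx1)). lra.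
  - intros _. split.
    + split; [|split]; intros x Hx.
      * apply (continue_in_comp cc01 P (fun p => (A - p) / m)); auto.
        auto_derive. exact I.
      * apply (continue_in_comp cc01 P (fun p => m ^ 2 / (A - p))); auto.
        auto_derive. specialize (IA x). lra.
      * apply Pc, Hx.
    + apply Dsub; [unfold oc01, cc01; intros; lra|].
      intros x Hx. specialize (PA x Hx). lra.
  - intros [_ L]. destruct (Pt L) as [xh [Ixh Hxh]].
    exists xh. split; [assumption|]. intros x Hx. destruct (Hxh x Hx) as [H1 H2].
    split; intros Lx.
    + apply gas_state_subsonic; auto.
    + apply gas_state_supersonic; auto.
  - intros L x Hx. apply gas_state_subsonic; auto.
    fold ps. specialize (PI x). unfold Rmin, Rmax in PI.
    destruct (Rle_dec p1 pe); lra.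
Qed.
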